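(* A logical connective $\mathcal{C}$ satisfies the deducibility of identicals condition if and only if $\mathcal{C}$ satisfies the reflection principle.
   Context: Setting: a sequent calculus (in the style of linear logic, without implication) with sequents $\Gamma \vdash \Delta$, the identity axiom $A\vdash A$ and cut. Visibility is assumed: active formulas of a rule for a connective are the only formulas on their side of the sequent. An $n$-ary logical connective $\mathcal{C}$ is a pair $(L,R)$ of sets of left rules and right rules introducing $\mathcal{C}(A_1,\dots,A_n)$ in the antecedent, resp. succedent, with premisses built from formulas among $A_1,\dots,A_n$ and context variables, such that the main step of cut elimination holds between them (a cut on $\mathcal{C}(A_1,\dots,A_n)$ between conclusions of a right and a left rule can be replaced by cuts on the $A_i$). Deducibility of identicals (DoI): for all $A_1,\dots,A_n$, the sequent $\mathcal{C}(A_1,\dots,A_n)\vdash\mathcal{C}(A_1,\dots,A_n)$ is derivable by first applying left (resp. right) rule(s) of $\mathcal{C}$ to identity axioms and then a right (resp. left) rule of $\mathcal{C}$, using no rules other than those of $\mathcal{C}$ and identity axioms. Reflection principle: take a set of rules of one side of $\mathcal{C}$ as formation rules, e.g. $\Gamma_1\vdash A_{11},\dots,A_{1k_1}\ \cdots\ \Gamma_m\vdash A_{m1},\dots,A_{mk_m}$ / $\Gamma'\vdash\mathcal{C}(A_1,\dots,A_n)$; the definitional equation states that the conclusion holds iff all the premisses hold; its ``only if'' direction gives implicit reflection rules (from the conclusion infer each premiss), and explicit reflection rules are obtained by substituting $\mathcal{C}(A_1,\dots,A_n)$ for the context (making the premiss an identity) and replacing the active formulas by contexts using cut (e.g. $A_{ij}\vdash\Delta$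 / $\mathcal{C}(A_1,\dots,A_n)\vdash\Delta$). The equation is solvable if the main step of cut elimination holds between the explicit reflection rules and the formation rule(s). $\mathcal{C}$ satisfies the reflection principle if its rules are a formation rule set and the explicit reflection rules of a solvable definitional equation, i.e. its rules are obtained by solving a definitional equation.
   Formalization: In the reflection principle, the rules of C need only be interderivable, side by side, with the solution of a definitional equation whose formation rules are a nonempty set of rules of C on one side; with literal equality the claim fails (e.g. & with a redundant left rule). *)

(* Defs.v *)
From mathcomp Require Import all_boot.
From Stdlib Require Import Permutation.
Set Implicit Arguments.
Unset Strict Implicit.
Unset Printing Implicit Defensive.

(** * Formulas and sequents *)

Record signature := Signature { conn :> Type; arity : conn -> nat }.

Inductive formula (S : signature) : Type :=
| Atom of nat
| App (c : S) of ('I_(arity c) -> formula S).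
Arguments Atom {S}.

Definition sequent (S : signature) := (seq (formula S) * seq (formula S))%type.

(* The two sides of a sequent are multisets: sequents are identified up to
   exchange, but there is neither weakening nor contraction. *)
Definition exchange (S : signature) (s t : sequent S) : Prop :=
  Permutation s.1 t.1 /\ Permutation s.2 t.2.

Definition identity (S : signature) (s : sequent S) : Prop :=
  exists A, s = ([:: A], [:: A]).

(** * Rules for a connective *)

Variant side := Left | Right.

Definition opp (d : side) : side := if d is Left then Right else Left.

Definition on_side (S : signature) (d : side) (P G : seq (formula S)) :
  sequent S := if d is Left then (P, G) else (G, P).

Definition cvar := nat.

(* A premiss [(G, a)] of a rule for an [n]-ary connective consists of a list [G]
   of context variables and of the indices [a] of its active formulas.  By
   visibility the active formulas are alone on the side on which the rule
   introduces the connective, and the context variables fill the other side: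
   [(G, [:: i1; ..; ik])] stands for [G |- A_i1, .., A_ik] in a right rule and
   for [A_i1, .., A_ik |- G] in a left rule. *)
Definition premiss (n : nat) := (seq cvar * seq 'I_n)%type.

(* With [rctx = G] the conclusion is [G |- C(A_1, .., A_n)] for a right rule and
   [C(A_1, .., A_n) |- G] for a left rule. *)
Record rule (n : nat) := Rule { prems : seq (premiss n); rctx : seq cvar }.

Section Instances.
Variables (S : signature) (c : S).
Implicit Types (d : side) (A : 'I_(arity c) -> formula S).
Implicit Types (g : cvar -> seq (formula S)).

Definition ctx_inst g (G : seq cvar) : seq (formula S) :=
  flatten [seq g v | v <- G].

Definition prem_inst d A g (p : premiss (arity c)) : sequent S :=
  on_side d [seq A i | i <- p.2] (ctx_inst g p.1).

Definition concl_inst d A g (r : rule (arity c)) : sequent S :=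
  on_side d [:: App A] (ctx_inst g (rctx r)).

Definition prems_inst d A g (r : rule (arity c)) (s : sequent S) : Prop :=
  exists2 p, p \in prems r & s = prem_inst d A g p.

Definition immediate A (B : formula S) : Prop := exists i, B = A i.

(* Derivability from the hypotheses [H] by means of identity axioms, of the
   rules [X] on side [d] and of cuts on formulas satisfying [K]. *)
Inductive derivable (K : formula S -> Prop) d (X : rule (arity c) -> Prop)
    (H : sequent S -> Prop) : sequent S -> Prop :=
| d_hyp s : H s -> derivable K d X H s
| d_id s : identity s -> derivable K d X H s
| d_exchange s t : exchange s t -> derivable K d X H s -> derivable K d X H t
| d_cut B G D G' D' : K B ->
    derivable K d X H (G, B :: D) -> derivable K d X H (B :: G', D') ->
    derivable K d X H (G ++ G', D ++ D')
| d_rule r A g : X r ->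
    (forall p, p \in prems r -> derivable K d X H (prem_inst d A g p)) ->
    derivable K d X H (concl_inst d A g r).

Definition cut_derivable A (H : sequent S -> Prop) : sequent S -> Prop :=
  derivable (immediate A) Left (fun=> False) H.

(* The main step of cut elimination: a cut on [C(A_1, .., A_n)] between the
   conclusions of a right rule and of a left rule can be replaced by cuts on the
   [A_i] between the premisses of the two rules. *)
Definition main_step (X : side -> rule (arity c) -> Prop) : Prop :=
  forall r l, X Right r -> X Left l ->
  forall A g h,
    cut_derivable A
      (fun s => prems_inst Right A g r s \/ prems_inst Left A h l s)
      (ctx_inst g (rctx r), ctx_inst h (rctx l)).

Definition derivable_rule d (X : rule (arity c) -> Prop) (r : rule (arity c)) :
  Prop :=
  forall A g,
    derivable (immediate A) d X (prems_inst d A g r) (concl_inst d A g r).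

Definition interderivable d (X Y : rule (arity c) -> Prop) : Prop :=
  (forall r, X r -> derivable_rule d Y r) /\
  (forall r, Y r -> derivable_rule d X r).

End Instances.

Record connective (S : signature) (c : S) := Connective {
  rules : side -> rule (arity c) -> Prop;
  rules_main_step : main_step rules
}.

(** * Deducibility of identicals *)

Section Conditions.
Variables (S : signature) (c : S).

Definition from_identities (C : connective c) (d : side)
    (A : 'I_(arity c) -> formula S) (s : sequent S) : Prop :=
  exists r g,
    [/\ rules C d r, exchange (concl_inst d A g r) s
      & forall p, p \in prems r -> identity (prem_inst d A g p)].

(* [C(A) |- C(A)] is derived by rules of side [opp d] applied to identity axioms
   followed by one rule of side [d]. *)
Definition identical_derivable (C : connective c) (d : side)
    (A : 'I_(arity c) -> formula S) : Prop :=
  exists r g,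
    [/\ rules C d r, concl_inst d A g r = ([:: App A], [:: App A])
      & forall p, p \in prems r ->
          from_identities C (opp d) A (prem_inst d A g p)].

Definition deducibility_of_identicals (C : connective c) : Prop :=
  forall A, exists d, identical_derivable C d A.

(** * Reflection principle *)

(* The definitional equation of a formation rule says that its conclusion holds
   if and only if all its premisses hold; the implicit reflection rules, from [s]
   infer [t], are the "only if" direction. *)
Definition implicit_reflection (d : side) (A : 'I_(arity c) -> formula S)
    (g : cvar -> seq (formula S)) (r : rule (arity c)) (s t : sequent S) : Prop :=
  s = concl_inst d A g r /\ prems_inst d A g r t.

(* Substitute [C(A)] for the context variables in [x], and the empty context for
   the others. *)
Definition plug (x : pred cvar) (A : 'I_(arity c) -> formula S) (v : cvar) :
  seq (formula S) := if x v then [:: App A] else [::].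

(* The substitution makes the premiss of the implicit reflection rules of [r] an
   identity, and their conclusions have [C(A)] alone on one side, i.e. they are
   [C(A) |- A_i1, .., A_ik] for a right rule [r], so that they can be conclusions
   of rules for the connective on side [opp d]. *)
Definition trivializes (d : side) (x : pred cvar) (r : rule (arity c)) : Prop :=
  forall A : 'I_(arity c) -> formula S,
    identity (concl_inst d A (plug x A) r) /\
    forall s t, implicit_reflection d A (plug x A) r s t ->
      exists P, t = on_side (opp d) [:: App A] P.

(* Cutting [C(A) |- A_i1, .., A_ik] with [A_i1 |- D_1], .., [A_ik |- D_k] gives
   the rule with these [k] premisses and conclusion [C(A) |- D_1, .., D_k]. *)
Definition explicit_rule (p : premiss (arity c)) : rule (arity c) :=
  Rule [seq ([:: x.1], [:: x.2]) | x <- zip (iota 0 (size p.2)) p.2]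
       (iota 0 (size p.2)).

Definition explicit_reflection (d : side) (F : rule (arity c) -> Prop)
    (e : rule (arity c)) : Prop :=
  exists r x p,
    [/\ F r, trivializes d x r, p \in prems r & e = explicit_rule p].

Definition solution (d : side) (F : rule (arity c) -> Prop) (d' : side) :
  rule (arity c) -> Prop :=
  match d, d' with
  | Left, Left | Right, Right => F
  | _, _ => explicit_reflection d F
  end.

Definition solvable (d : side) (F : rule (arity c) -> Prop) : Prop :=
  (forall r, F r -> exists x, trivializes d x r) /\ main_step (solution d F).

(* The rules of [C] are compared with the solution of the definitional equation
   up to interderivability on each side, since [C] may have further, redundant
   rules and its rules may be presented differently. *)
Definition reflection_principle (C : connective c) : Prop :=
  exists d (F : rule (arity c) -> Prop),
    [/\ exists r, F r,
        forall r, F r -> rules C d r,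
        solvable d F
      & forall d', interderivable d' (rules C d') (solution d F d')].

End Conditions.

(* Main.v *)
Require Import Defs.
From mathcomp Require Import all_boot.
From Stdlib Require Import Permutation.
Set Implicit Arguments.
Unset Strict Implicit.
Unset Printing Implicit Defensive.

(** Everything is tested on the generic instance [A_i := Atom i]. There the
    deducibility of identicals provides a rule [r] on one side and, for each of
    its premisses [p], a rule on the other side which proves, from identities,
    the explicit reflection axiom of [p], e.g. [C(A) |- A_i1, .., A_ik];
    replacing atoms by formulas transports this to every instance. Cutting this
    axiom against an arbitrary rule of [C], by the main step, shows that [r]
    alone is a formation rule whose definitional equation is solved by the
    rules of [C].

    Conversely, cuts can be eliminated on the generic instance: with
    rules from one side only, every derivable sequent has a single formula on
    that side, and a derivable sequent with an atom there is an identity. So all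
    cuts on the [A_i] are trivial, and a derivation of [C(A) |- A_i1, .., A_ik]
    ends with a rule applied to identities. *)

(** * Sequents read from a chosen side *)

Lemma on_side_opp (S : signature) d (P G : seq (formula S)) :
  on_side (opp d) P G = on_side d G P.
Proof. by case: d. Qed.

Lemma on_side_inj (S : signature) d (P G P' G' : seq (formula S)) :
  on_side d P G = on_side d P' G' -> P = P' /\ G = G'.
Proof. by case: d => -[-> ->]. Qed.

Lemma identity_on_side (S : signature) d (P G : seq (formula S)) :
  identity (on_side d P G) <-> exists B, P = [:: B] /\ G = [:: B].
Proof.
by case: d; split=> [[B [-> ->]]|[B [-> ->]]]; exists B.
Qed.

Lemma exchange_on_side (S : signature) d (P G P' G' : seq (formula S)) :
  exchange (on_side d P G) (on_side d P' G') <->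
  Permutation P P' /\ Permutation G G'.
Proof. by case: d; split=> -[]. Qed.

Lemma sequent_on_side (S : signature) d (s : sequent S) :
  exists P G, s = on_side d P G.
Proof. by case: d s => -[P G]; [exists P, G | exists G, P]. Qed.

Section Derivations.
Variables (S : signature) (c : S).
Implicit Types (d e : side) (A : 'I_(arity c) -> formula S).
Implicit Types (g h : cvar -> seq (formula S)).

(** * Derivations with cuts and the main step, on either side *)

Section SidedCut.
Variables (K : formula S -> Prop) (e : side) (X : rule (arity c) -> Prop).
Variable H : sequent S -> Prop.

Lemma d_cut_side d B P G P' G' : K B ->
  derivable K e X H (on_side d (B :: P) G) ->
  derivable K e X H (on_side d P' (B :: G')) ->
  derivable K e X H (on_side d (P ++ P') (G ++ G')).
Proof.
move=> KB; case: d => /= D1 D2; last exact: d_cut D1 D2.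
by apply: d_exchange (d_cut KB D2 D1); split; apply: Permutation_app_comm.
Qed.

Lemma d_exchange_side d P G P' G' : Permutation P P' -> Permutation G G' ->
  derivable K e X H (on_side d P G) -> derivable K e X H (on_side d P' G').
Proof.
by move=> pP pG; apply: d_exchange; apply/exchange_on_side.
Qed.

Lemma d_id_side d B : derivable K e X H (on_side d [:: B] [:: B]).
Proof. by apply: d_id; apply/identity_on_side; exists B. Qed.

(** The active formulas are cut one at a time: [P] collects the contexts that have already replaced
    one, and [m] is the next context variable. *)
Lemma d_cut_family d A g G (a : seq 'I_(arity c)) m P :
  (forall i, K (A i)) ->
  derivable K e X H (on_side d ([seq A i | i <- a] ++ P) G) ->
  (forall x, x \in zip (iota m (size a)) a ->
     derivable K e X H (on_side d (g x.1) [:: A x.2])) ->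
  derivable K e X H (on_side d (P ++ ctx_inst g (iota m (size a))) G).
Proof.
move=> KA; elim: a m P => [|i a IH] m P /= D0 Da.
  by rewrite /ctx_inst /= cats0.
rewrite /ctx_inst /= catA; apply: IH => [|x xa]; last first.
  by apply: Da; rewrite inE xa orbT.
have Di := Da (m, i) (mem_head _ _).
have := d_cut_side (KA i) D0 Di; rewrite cats0 -catA.
by apply: d_exchange_side.
Qed.

End SidedCut.

(** The derivation of [s] uses no rule of the connective, so it can be grafted onto rules of any
    side. *)
Lemma derivable_bind K e d (X : rule (arity c) -> Prop) H H' s :
  derivable (c := c) K e (fun=> False) H s ->
  (forall t, H t -> derivable K d X H' t) -> derivable K d X H' s.
Proof.
move=> Ds HH'; elim: Ds => {s} [s /HH'||s t st _|B G D G' D' KB _ D1 _ D2|] //.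
- exact: d_id.
- exact: d_exchange.
- exact: d_cut D1 D2.
Qed.

Lemma main_step_on_side (X : side -> rule (arity c) -> Prop) d r l A g h :
  main_step X -> X d r -> X (opp d) l ->
  cut_derivable A
    (fun s => prems_inst d A g r s \/ prems_inst (opp d) A h l s)
    (on_side d (ctx_inst h (rctx l)) (ctx_inst g (rctx r))).
Proof.
move=> mX; case: d => /= Xr Xl; last exact: mX.
apply: derivable_bind (mX l r Xl Xr A h g) _ => t Ht.
by apply: d_hyp; case: Ht; [right | left].
Qed.

Lemma main_step_from_side (X : side -> rule (arity c) -> Prop) d :
  (forall r l, X d r -> X (opp d) l -> forall A g h,
    cut_derivable A
      (fun s => prems_inst d A g r s \/ prems_inst (opp d) A h l s)
      (on_side d (ctx_inst h (rctx l)) (ctx_inst g (rctx r)))) ->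
  main_step X.
Proof.
case: d => /= mX r l Xr Xl A g h; last exact: mX.
apply: derivable_bind (mX l r Xl Xr A h g) _ => t Ht.
by apply: d_hyp; case: Ht; [right | left].
Qed.

(** * Contexts filled by a single formula *)

Lemma ctx_inst_plug x A G : ctx_inst (plug x A) G = nseq (count x G) (App A).
Proof.
by elim: G => //= v G; rewrite /ctx_inst /= => ->; rewrite /plug; case: (x v).
Qed.

Lemma ctx_inst_singleton (x : pred cvar) (D : seq (formula S)) G : count x G = 1 ->
  ctx_inst (fun v => if x v then D else [::]) G = D.
Proof.
have E0 G' : count x G' = 0 ->
    ctx_inst (fun v => if x v then D else [::]) G' = [::].
  by elim: G' => //= v G' IH; rewrite /ctx_inst /=; case: (x v).
elim: G => //= v G IH; rewrite /ctx_inst /=; case: (x v) => //= -[/E0].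
by rewrite /ctx_inst => ->; rewrite cats0.
Qed.

(** The sizes of the substituted contexts add up to one. This recovers a trivializing set of
    variables from a substitution met in a derivation. *)
Lemma count_nonempty g G B : ctx_inst g G = [:: B] ->
  count (fun v => size (g v) != 0) G = 1.
Proof.
move=> /(congr1 size); rewrite /ctx_inst size_flatten /shape -map_comp /=.
have E0 G' : sumn [seq size (g v) | v <- G'] = 0 ->
    count (fun v => size (g v) != 0) G' = 0.
  by elim: G' => //= v G' IH; case: (size (g v)).
elim: G => //= v G IH; case: (size (g v)) => [|[|k]] //= -[] //.
by move=> /E0 ->.
Qed.

(** [plug x A] yields one copy of [App A] per occurrence of a variable in [x], so the condition is a
    count independent of [A]. *)
Lemma trivializesP d x (r : rule (arity c)) :
  trivializes (S := S) d x r <->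
  count x (rctx r) = 1 /\ forall p, p \in prems r -> count x p.1 = 1.
Proof.
split=> [tr|[xr xp] A].
  have [] := tr (fun i => Atom i) => /identity_on_side[B []] _.
  rewrite ctx_inst_plug => /(congr1 size); rewrite size_nseq => xr tp.
  split=> // p pr.
  have [P] := tp _ _ (conj erefl (ex_intro2 _ _ p pr erefl)).
  rewrite on_side_opp => /on_side_inj[_].
  by rewrite ctx_inst_plug => /(congr1 size); rewrite size_nseq.
split=> [|_ _ [_ [p pr ->]]].
  by apply/identity_on_side; exists (App A); rewrite ctx_inst_plug xr.
by exists [seq A i | i <- p.2]; rewrite on_side_opp /prem_inst ctx_inst_plug xp.
Qed.

(* Indexing the arguments by [nat] makes [App] injective in them without
   uniqueness of identity proofs on the connectives. *)
Definition args (B : formula S) (k : nat) : option (formula S) :=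
  if B is App c' f then
    if insub k : option 'I_(arity c') is Some i then Some (f i) else None
  else None.

Lemma App_inj A A' : App A = App A' -> A =1 A'.
Proof.
move=> eqA i; have := congr1 (args ^~ i) eqA.
by rewrite /= valK => -[].
Qed.

(** * The generic instance and its specializations *)

Definition generic (i : 'I_(arity c)) : formula S := Atom i.

(** Compound formulas are left alone: [identities_yield] does not mention [App A], so mapping
    contexts formula by formula transports it. *)
Definition specialize A (B : formula S) : formula S :=
  if B is Atom k then if insub k is Some i then A i else B else B.

Lemma specialize_generic A a :
  [seq specialize A B | B <- [seq generic i | i <- a]] = [seq A i | i <- a].
Proof. by rewrite -map_comp; apply: eq_map => i /=; rewrite valK. Qed.

Lemma ctx_inst_map (f : formula S -> formula S) g G :
  ctx_inst (fun v => map f (g v)) G = map f (ctx_inst g G).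
Proof. by rewrite /ctx_inst map_flatten -map_comp. Qed.

(* [from_identities], read off as a property of the side opposite to the
   connective, so that it transports along instances. *)
Definition identities_yield (X : rule (arity c) -> Prop) A D : Prop :=
  exists l g, [/\ X l, Permutation (ctx_inst g (rctx l)) D
    & forall q, q \in prems l ->
        exists2 i, q.2 = [:: i] & ctx_inst g q.1 = [:: A i]].

Lemma identities_yield_specialize X A a :
  identities_yield X generic [seq generic i | i <- a] ->
  identities_yield X A [seq A i | i <- a].
Proof.
move=> [l [g [Xl pl ql]]]; exists l, (fun v => map (specialize A) (g v)).
split=> // [|q /ql[i q2 q1]].
  by rewrite ctx_inst_map -specialize_generic; exact: Permutation_map.
by exists i; rewrite // ctx_inst_map q1 /= valK.
Qed.

Lemma from_identitiesP (C : connective c) d A D :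
  from_identities C d A (on_side d [:: App A] D) <->
  identities_yield (rules C d) A D.
Proof.
split=> [[l [g [Cl /exchange_on_side[_ pl] ql]]]|[l [g [Cl pl ql]]]].
  exists l, g; split=> // q /ql/identity_on_side[B [q2 q1]].
  by move: q.2 q2 => [|i [|? ?]] //= [qB]; exists i; rewrite ?q1 ?qB.
exists l, g; split=> // [|q /ql[i q2 q1]]; first exact/exchange_on_side.
by apply/identity_on_side; exists (A i); rewrite q2 q1.
Qed.

Lemma identities_yield_derivable X d A D K H : identities_yield X A D ->
  derivable K d X H (on_side d [:: App A] D).
Proof.
move=> [l [g [Xl pl ql]]].
apply: (d_exchange_side (Permutation_refl [:: App A]) pl).
apply: d_rule Xl _ => q /ql[i q2 q1].
by rewrite /prem_inst q2 q1; apply: d_id_side.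
Qed.

(** The opposite rule has only identities as premisses, so the main step leaves just the premisses
    of [r] as hypotheses. *)
Lemma main_step_identities X d A D r g :
  main_step X -> X d r -> identities_yield (X (opp d)) A D ->
  cut_derivable A (prems_inst d A g r) (on_side d D (ctx_inst g (rctx r))).
Proof.
move=> mX Xr [l [h [Xl pl ql]]].
apply: (d_exchange_side pl (Permutation_refl _)).
apply: derivable_bind (main_step_on_side A g h mX Xr Xl) _ => t [Ht|].
  exact: d_hyp.
move=> [q /ql[i q2 q1] ->]; rewrite /prem_inst q2 q1 /=; exact: d_id_side.
Qed.

(** * Explicit reflection rules *)

Lemma explicit_rule_derivable K e (X : rule (arity c) -> Prop) H d A g p Q :
  (forall i, K (A i)) ->
  derivable K e X H (on_side d [seq A i | i <- p.2] Q) ->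
  (forall q, q \in prems (explicit_rule p) ->
     derivable K e X H (prem_inst (opp d) A g q)) ->
  derivable K e X H (on_side d (ctx_inst g (rctx (explicit_rule p))) Q).
Proof.
move=> KA Dp Dq.
apply: (d_cut_family (P := [::]) (A := A)) => //; first by rewrite cats0.
move=> x xp; have := Dq ([:: x.1], [:: x.2]).
rewrite /prem_inst on_side_opp /ctx_inst /= cats0; apply.
by apply/mapP; exists x.
Qed.

Lemma flatten_onth (T U : Type) (f : T -> U) s :
  flatten [seq (if onth s v is Some i then [:: f i] else [::])
          | v <- iota 0 (size s)] = map f s.
Proof.
elim: s => //= i s IH; congr (_ :: _).
by rewrite -[in LHS]add1n iotaDl -map_comp -[RHS]IH.
Qed.

Lemma mem_zip_iota (T : eqType) (s : seq T) x :
  x \in zip (iota 0 (size s)) s -> onth s x.1 = Some x.2.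
Proof.
case: x => k i ks; have [j] := nthP (0, i) ks.
rewrite size_zip size_iota minnn => js.
rewrite nth_zip ?size_iota // nth_iota // => -[<- <-] /=.
by rewrite onthE (nth_map i).
Qed.

Lemma explicit_rule_identities (X : rule (arity c) -> Prop) p A :
  X (explicit_rule p) -> identities_yield X A [seq A i | i <- p.2].
Proof.
(* The context variable [k] receives the active formula at position [k]; the default lies outside
   the variables of the rule. *)
move=> Xp; pose g v := if onth p.2 v is Some i then [:: A i] else [::].
exists (explicit_rule p), g; split=> // [|_ /mapP[x xp ->]].
  by rewrite /ctx_inst flatten_onth.
by exists x.2; rewrite // /ctx_inst /= cats0 /g (mem_zip_iota xp).
Qed.

(** * Cut elimination on the generic instance *)

Lemma identities_yield_perm X A D D' :
  Permutation D D' -> identities_yield X A D -> identities_yield X A D'.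
Proof.
move=> pD [l [g [Xl pl ql]]]; exists l, g; split=> //.
exact: Permutation_trans pD.
Qed.

Definition generic_normal X d (s : sequent S) : Prop :=
  exists B D, [/\ s = on_side d [:: B] D,
    forall k, B = Atom k -> D = [:: B]
  & forall A, B = App A -> A =1 generic ->
      D = [:: B] \/ identities_yield X generic D].

Lemma generic_normal_exchange X d s t :
  exchange s t -> generic_normal X d s -> generic_normal X d t.
Proof.
move=> st [B [D [Es HA HC]]]; rewrite {s}Es in st.
have [P [G Et]] := sequent_on_side d t; rewrite {t}Et in st *.
move/exchange_on_side: st => [pP pG]; rewrite (Permutation_length_1_inv pP).
have HG B' : D = [:: B'] -> G = [:: B'].
  by move=> ED; apply: Permutation_length_1_inv; rewrite -ED.
exists B, G; split=> // [k /HA/HG //|A BA /(HC A BA)[/HG|]]; first by left.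
by right; apply: identities_yield_perm pG _.
Qed.

Lemma derivable_generic X d H s : (forall t, H t -> identity t) ->
  derivable (immediate generic) d X H s -> generic_normal X d s.
Proof.
have idP t : identity t -> generic_normal X d t.
  move=> [B ->]; exists B, [:: B]; split=> //; last by left.
  by case: d.
move=> idH; elim=> {s} [s /idH/idP||s t st _|B G D G' D' [i ->] _ D1 _ D2|] //.
- exact: generic_normal_exchange.
(* The premiss with the cut atom on side [d] is an identity, so the cut gives back its other premiss
   up to exchange. *)
- case: d {idP} D1 D2 => /= D1 D2.
    have [B2 [E2 [[<- -> ->] HA _]]] := D2.
    rewrite (HA _ erefl) cats0; apply: generic_normal_exchange D1.
    split=> //=; exact: (Permutation_app_comm [:: _] D).
  have [B1 [E1 [[-> <- ->] HA _]]] := D1.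
  by rewrite (HA _ erefl).
- move=> r A g Xr _ IH; exists (App A), (ctx_inst g (rctx r)).
  split=> // A' /App_inj AA' A'gen; right; exists r, g; split=> // q qr.
  (* By induction each premiss has one active formula; it is an atom, so the premiss is an
     identity. *)
  have [B [D [/on_side_inj[Eq ->] HA _]]] := IH q qr.
  move: q.2 Eq => [|i [|? ?]] //= [EB]; exists i => //.
  have EB' : B = generic i by rewrite -EB AA' A'gen.
  by rewrite (HA i) ?EB'.
Qed.

(** * Reflective rules, the middle term between the two conditions *)

Definition reflective_rule (C : connective c) d x r : Prop :=
  [/\ rules C d r, trivializes (S := S) d x r
    & forall p A, p \in prems r ->
        identities_yield (rules C (opp d)) A [seq A i | i <- p.2]].

Lemma doi_reflective_rule (C : connective c) :
  deducibility_of_identicals C -> exists d x r, reflective_rule C d x r.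
Proof.
move=> /(_ generic)[d [r [g [Cr Er Hp]]]].
have Erc : ctx_inst g (rctx r) = [:: App generic] by case: d Er {Cr Hp} => -[].
have Hp' p : p \in prems r -> ctx_inst g p.1 = [:: App generic] /\
    identities_yield (rules C (opp d)) generic [seq generic i | i <- p.2].
  move=> /Hp fp.
  have Ep : ctx_inst g p.1 = [:: App generic].
    have [l [h [_ + _]]] := fp.
    rewrite /concl_inst /prem_inst on_side_opp => /exchange_on_side[_].
    exact: Permutation_length_1_inv.
  by split=> //; apply/from_identitiesP; rewrite on_side_opp -Ep.
(* The trivializing variables are those that the generic derivation fills with [C(A)]. *)
exists d, (fun v => size (g v) != 0), r; split=> // [|p A /Hp'[_]].
  apply/trivializesP; split=> [|p /Hp'[Ep _]]; last exact: count_nonempty Ep.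
  exact: count_nonempty Erc.
exact: identities_yield_specialize.
Qed.

Lemma reflective_rule_doi (C : connective c) d x r :
  reflective_rule C d x r -> deducibility_of_identicals C.
Proof.
move=> [Cr /trivializesP[xr xp] Hp] A; exists d, r, (plug x A).
split=> // [|p pr]; first by rewrite /concl_inst ctx_inst_plug xr; case: d {Cr Hp}.
rewrite /prem_inst ctx_inst_plug xp // -on_side_opp.
by apply/from_identitiesP; apply: Hp.
Qed.

Lemma solution_same d F : solution (S := S) (c := c) d F d = F.
Proof. by case: d. Qed.

Lemma solution_opp d F :
  solution (c := c) d F (opp d) = explicit_reflection (S := S) d F.
Proof. by case: d. Qed.

Lemma interderivable_on_sides d (X Y : side -> rule (arity c) -> Prop) :
  interderivable (S := S) d (X d) (Y d) ->
  interderivable (S := S) (opp d) (X (opp d)) (Y (opp d)) ->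
  forall d', interderivable (S := S) d' (X d') (Y d').
Proof. by case: d => ? ? []. Qed.

Lemma reflective_rule_reflection (C : connective c) d x r :
  reflective_rule C d x r -> reflection_principle C.
Proof.
move=> [Cr tr Hp]; have [xr xp] := (trivializesP _ _ _).1 tr.
have immA A i : immediate A (A i) by exists i.
have mC := @rules_main_step _ _ C.
exists d, (eq r); split; [by exists r|by move=> _ <-| |].
  split=> [_ <-|]; first by exists x.
  apply: (@main_step_from_side _ d) => r' e; rewrite solution_same solution_opp.
  move=> <- [_ [y [p [<- _ pr ->]]]] A g h.
  apply: (explicit_rule_derivable (A := A)) => // [|q qp]; last first.
    by apply: d_hyp; right; exists q.
  (* The main step of [C] gives the active formulas of [p] with the conclusion context of [r], ready
     to be cut. *)
  apply: derivable_bind (main_step_identities g mC Cr (Hp p A pr)) _ => t Ht.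
  by apply: d_hyp; left.
apply: (@interderivable_on_sides d); rewrite ?solution_same ?solution_opp.
  split=> [r' Cr' A g|_ <- A g]; last first.
    by apply: d_rule => // p pr; apply: d_hyp; exists p.
  (* The whole context of [r'] goes into the single occurrence of [x], so [r] concludes what [r']
     does. *)
  pose h v := if x v then ctx_inst g (rctx r') else [::].
  have -> : concl_inst d A g r' = concl_inst d A h r.
    by rewrite /concl_inst ctx_inst_singleton.
  apply: d_rule => // p pr; rewrite /prem_inst ctx_inst_singleton ?xp //.
  apply: derivable_bind (main_step_identities g mC Cr' (Hp p A pr)) _ => t Ht.
  exact: d_hyp.
split=> [l Cl A g|_ [_ [y [p [<- _ pr ->]]]] A g].
  (* With [C(A)] as context, [r] concludes an identity and its premisses are the explicit reflection
     axioms; cutting against [l] keeps the conclusion of [l]. *)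
  have := main_step_on_side A (plug x A) g mC Cr Cl.
  rewrite ctx_inst_plug xr -on_side_opp => D.
  apply: derivable_bind D _ => t [[p pr ->]|Ht]; last exact: d_hyp.
  rewrite /prem_inst ctx_inst_plug xp // -on_side_opp.
  apply: identities_yield_derivable; apply: explicit_rule_identities.
  by exists r, x, p.
rewrite /concl_inst on_side_opp.
apply: (explicit_rule_derivable (A := A)) => // [|q qp]; last first.
  by apply: d_hyp; exists q.
by rewrite -on_side_opp; apply: identities_yield_derivable; apply: Hp.
Qed.

Lemma reflection_reflective_rule (C : connective c) :
  reflection_principle C -> exists d x r, reflective_rule C d x r.
Proof.
move=> [d [F [[r Fr] FC [tF _] intF]]]; have [x tr] := tF r Fr.
exists d, x, r; split=> // [|p A pr]; first exact: FC.
apply: identities_yield_specialize.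
have [_ /(_ (explicit_rule p))] := intF (opp d); rewrite solution_opp.
have Ep : explicit_reflection (S := S) d F (explicit_rule p) by exists r, x, p.
move=> /(_ Ep){Ep}.
(* [g] turns the premisses of the explicit rule into generic identities and its conclusion into the
   reflection axiom of [p]. *)
have [_ [g [<- pg qg]]] :=
  explicit_rule_identities generic (erefl (explicit_rule p)).
move=> /(_ generic g) De.
have [|B [D [+ _ HC]]] := derivable_generic _ De.
  move=> _ [q /qg[i q2 q1] ->].
  by apply/identity_on_side; exists (generic i); rewrite q2 q1.
move=> /on_side_inj[[EB] ED]; rewrite -{}ED -{}EB in HC.
(* The identity case would make a generic atom equal to [App generic]. *)
have [//|E|] := HC generic erefl; last exact: identities_yield_perm.
rewrite E in pg; have := Permutation_length_1_inv pg.
by case: p.2 => [|i []].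
Qed.

End Derivations.

Theorem theorem1 (S : signature) (c : S) (C : connective c) :
  deducibility_of_identicals C <-> reflection_principle C.
Proof.
split=> [/doi_reflective_rule|/reflection_reflective_rule] [d [x [r]]].
  exact: reflective_rule_reflection.
exact: reflective_rule_doi.
Qed.
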